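(* Let $C$ be any real $m\times k$ matrix and $R$ any real $k\times n$ matrix, and let $A = CR$. Then the pseudoinverse of $A$ is given by $$A^+ = (CR)^+ = (C^+CR)^+\,(CRR^+)^+ .$$
   Context: For a real $p\times q$ matrix $M$, $M^+$ denotes its Moore–Penrose pseudoinverse: the unique real $q\times p$ matrix satisfying the four Penrose identities $MM^+M=M$, $M^+MM^+=M^+$, $(M^+M)^{\mathrm T}=M^+M$, $(MM^+)^{\mathrm T}=MM^+$. No rank assumptions are made on $C$ and $R$. *)

(* Defs.v *)
From mathcomp Require Import all_boot all_order all_algebra.
From mathcomp Require Import reals.

Set Implicit Arguments.
Unset Strict Implicit.
Unset Printing Implicit Defensive.

Import Order.TTheory GRing.Theory Num.Theory.
Local Open Scope ring_scope.

(* The four Penrose identities, X being a pseudoinverse of M. *)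
Definition penrose (F : realFieldType) (p q : nat)
    (M : 'M[F]_(p, q)) (X : 'M[F]_(q, p)) : bool :=
  [&& M *m X *m M == M,
      X *m M *m X == X,
      (X *m M)^T == X *m M &
      (M *m X)^T == M *m X].

Lemma penrose_uniq (F : realFieldType) (p q : nat) (M : 'M[F]_(p, q))
    (X Y : 'M[F]_(q, p)) : penrose M X -> penrose M Y -> X = Y.
Proof.
case/and4P=> /eqP MXM /eqP XMX /eqP sXM /eqP sMX.
case/and4P=> /eqP MYM /eqP YMY /eqP sYM /eqP sMY.
have eM : M *m X = M *m Y.
  by rewrite -{1}MYM -mulmxA -sMY -{1}sMX -trmx_mul mulmxA MXM sMY.
have eX : X *m M = Y *m M.
  by rewrite -{1}MYM -(mulmxA M) mulmxA -sXM -{1}sYM -trmx_mul -mulmxA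
             (mulmxA M) MXM sYM.
by rewrite -XMX -mulmxA eM mulmxA eX YMY.
Qed.

Lemma gram_unit (F : realFieldType) (r n : nat) (B : 'M[F]_(r, n)) :
  row_free B -> B *m B^T \in unitmx.
Proof.
move=> fB; rewrite -row_free_unit; apply/row_freeP.
suff fG : row_free (B *m B^T) by apply/row_freeP.
rewrite -kermx_eq0; apply/eqP/row_matrixP => i; rewrite row0.
set v := row i _.
have vG : v *m (B *m B^T) = 0.
  by apply/sub_kermxP; rewrite row_sub.
have nv : (v *m B) *m (v *m B)^T = 0.
  by rewrite trmx_mul mulmxA -(mulmxA v) vG mul0mx.
have vB : v *m B = 0.
  move: (v *m B) nv => w ww0; apply/rowP => j; rewrite [RHS]mxE.
  have /eqP : \sum_l w 0 l ^+ 2 = 0.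
    have /matrixP/(_ 0 0) := ww0; rewrite !mxE; apply: etrans.
    by apply: eq_bigr => l _; rewrite mxE expr2.
  rewrite psumr_eq0 => [|l _]; last exact: sqr_ge0.
  by move/allP/(_ j (mem_index_enum _)); rewrite /= sqrf_eq0 => /eqP.
by apply: (row_free_inj fB); rewrite mul0mx.
Qed.

Lemma penrose_exists (F : realFieldType) (p q : nat) (M : 'M[F]_(p, q)) :
  exists X : 'M[F]_(q, p), penrose M X.
Proof.
have [r [A [B [eM fA fB]]]] : exists r (A : 'M[F]_(p, r)) (B : 'M[F]_(r, q)),
    [/\ M = A *m B, row_full A & row_free B].
  exists (\rank M), (col_base M), (row_base M).
  by rewrite mulmx_base col_base_full row_base_free.
have uB : B *m B^T \in unitmx by exact: gram_unit.
have uA : A^T *m A \in unitmx.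
  have := @gram_unit F _ _ A^T; rewrite trmxK; apply.
  by rewrite /row_free mxrank_tr.
set Bi := B^T *m invmx (B *m B^T); set Ai := invmx (A^T *m A) *m A^T.
have BBi : B *m Bi = 1%:M by rewrite /Bi mulmxA mulmxV.
have AiA : Ai *m A = 1%:M by rewrite /Ai -mulmxA mulVmx.
have MX : M *m (Bi *m Ai) = A *m Ai.
  by rewrite eM mulmxA -(mulmxA A) BBi mulmx1.
have XM : (Bi *m Ai) *m M = Bi *m B.
  by rewrite eM mulmxA -(mulmxA Bi) AiA mulmx1.
exists (Bi *m Ai); apply/and4P; split; rewrite ?MX ?XM.
- by rewrite eM mulmxA -(mulmxA A) AiA mulmx1.
- by rewrite mulmxA -(mulmxA Bi) BBi mulmx1.
- by rewrite /Bi !trmx_mul trmxK trmx_inv trmx_mul trmxK mulmxA.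
- by rewrite /Ai !trmx_mul trmxK trmx_inv trmx_mul trmxK mulmxA.
Qed.

(* The Moore-Penrose pseudoinverse: the X selected by [penrose_exists], unique by
   [penrose_uniq]. It differs from mxalgebra's [pinvmx], for which the two
   symmetry identities fail in general. *)
Definition mpinvmx (F : realFieldType) (p q : nat) (M : 'M[F]_(p, q)) :
    'M[F]_(q, p) :=
  xchoose (penrose_exists M).

Lemma mpinvmxP (F : realFieldType) (p q : nat) (M : 'M[F]_(p, q)) :
  penrose M (mpinvmx M).
Proof. exact: xchooseP. Qed.

Lemma mpinvmx_eq (F : realFieldType) (p q : nat) (M : 'M[F]_(p, q))
    (X : 'M[F]_(q, p)) : penrose M X -> mpinvmx M = X.
Proof. exact: penrose_uniq (mpinvmxP M). Qed.

(* Main.v *)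
Require Import Defs.
From mathcomp Require Import all_boot all_order all_algebra.
From mathcomp Require Import reals.

(** Write P = C^+ C and Q = R R^+ for the orthogonal projectors onto the row
space of C and the column space of R, and put B = P R, D = C Q, so that
A = C R satisfies A = C B = D R.  The claim is that Z = B^+ D^+ satisfies the
Penrose identities for A; no reverse-order law (X Y)^+ = Y^+ X^+ is involved.

Since P B = B and D Q = D, the pseudoinverses absorb the projectors:
B^+ P = B^+ and Q D^+ = D^+ ([mpinvmx_absorbr], [mpinvmx_absorbl]).  Moreover
P Q = B R^+ = C^+ D, so B B^+ fixes P Q on the left and D^+ D fixes it on the
right.  Hence the product P Q can be inserted into and removed from A Z and
Z A, which gives A Z = D D^+ and Z A = B^+ B ([mpinvmx_mul_projections]).  Both
are symmetric, and they are projectors through which A and Z factor: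
D D^+ A = A because A = D R, and B^+ B Z = Z because Z = B^+ D^+. *)

Set Implicit Arguments.
Unset Strict Implicit.
Unset Printing Implicit Defensive.

Import Order.TTheory GRing.Theory Num.Theory.
Local Open Scope ring_scope.

Lemma mulmx_mpinvmxK (F : realFieldType) (p q : nat) (M : 'M[F]_(p, q)) :
  M *m mpinvmx M *m M = M.
Proof. by case/and4P: (mpinvmxP M) => /eqP. Qed.

Lemma mpinvmx_mulmxK (F : realFieldType) (p q : nat) (M : 'M[F]_(p, q)) :
  mpinvmx M *m M *m mpinvmx M = mpinvmx M.
Proof. by case/and4P: (mpinvmxP M) => _ /eqP. Qed.

Lemma trmx_mpinvmx_mul (F : realFieldType) (p q : nat) (M : 'M[F]_(p, q)) :
  (mpinvmx M *m M)^T = mpinvmx M *m M.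
Proof. by case/and4P: (mpinvmxP M) => _ _ /eqP. Qed.

Lemma trmx_mul_mpinvmx (F : realFieldType) (p q : nat) (M : 'M[F]_(p, q)) :
  (M *m mpinvmx M)^T = M *m mpinvmx M.
Proof. by case/and4P: (mpinvmxP M) => _ _ _ /eqP. Qed.

(** The kernel of M^+ is the orthogonal complement of the column space of M,
so a symmetric P that fixes this column space is invisible to M^+.
Algebraically: transpose P (M M^+) = M M^+. *)
Lemma mpinvmx_absorbr (F : realFieldType) (p q : nat) (M : 'M[F]_(p, q))
    (P : 'M[F]_p) :
  P^T = P -> P *m M = M -> mpinvmx M *m P = mpinvmx M.
Proof.
move=> sP PM.
have MMP : M *m mpinvmx M *m P = M *m mpinvmx M.
  by rewrite -{1}trmx_mul_mpinvmx -{1}sP -trmx_mul mulmxA PM trmx_mul_mpinvmx.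
by rewrite -{1}mpinvmx_mulmxK -!mulmxA (mulmxA M) MMP mulmxA mpinvmx_mulmxK.
Qed.

(** The range of M^+ is the row space of M: the mirror image of
[mpinvmx_absorbr]. *)
Lemma mpinvmx_absorbl (F : realFieldType) (p q : nat) (M : 'M[F]_(p, q))
    (Q : 'M[F]_q) :
  Q^T = Q -> M *m Q = M -> Q *m mpinvmx M = mpinvmx M.
Proof.
move=> sQ MQ.
have QMM : Q *m (mpinvmx M *m M) = mpinvmx M *m M.
  by rewrite -{1}trmx_mpinvmx_mul -{1}sQ -trmx_mul -mulmxA MQ trmx_mpinvmx_mul.
by rewrite -{1}mpinvmx_mulmxK mulmxA QMM mpinvmx_mulmxK.
Qed.

(** The two projectors of B^+ D^+ relative to C R are B^+ B and D D^+.  In both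
computations the product P Q serves as a bridge: it is B R^+ as well as
C^+ D, and it disappears between B^+ and D^+. *)
Lemma mpinvmx_mul_projections (F : realFieldType) (m k n : nat)
    (C : 'M[F]_(m, k)) (R : 'M[F]_(k, n)) :
  let B := mpinvmx C *m C *m R in
  let D := C *m R *m mpinvmx R in
  let Z := mpinvmx B *m mpinvmx D in
  C *m R *m Z = D *m mpinvmx D /\ Z *m (C *m R) = mpinvmx B *m B.
Proof.
move=> B D Z.
set P := mpinvmx C *m C; set Q := R *m mpinvmx R.
have CP : C *m P = C by rewrite mulmxA mulmx_mpinvmxK.
have QR : Q *m R = R by exact: mulmx_mpinvmxK.
have CB : C *m B = C *m R by rewrite mulmxA CP.
have DR : D *m R = C *m R by rewrite /D -!mulmxA (mulmxA R) QR.
have BP : mpinvmx B *m P = mpinvmx B.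
  apply: mpinvmx_absorbr; first exact: trmx_mpinvmx_mul.
  by rewrite /P /B !mulmxA mpinvmx_mulmxK.
have QD : Q *m mpinvmx D = mpinvmx D.
  apply: mpinvmx_absorbl; first exact: trmx_mul_mpinvmx.
  by rewrite /D -(mulmxA C) -/Q -mulmxA (mulmxA Q) QR.
have BB_PQ : B *m mpinvmx B *m (P *m Q) = P *m Q.
  have -> : P *m Q = B *m mpinvmx R by rewrite /B -mulmxA.
  by rewrite mulmxA mulmx_mpinvmxK.
have PQ_DD : P *m Q *m (mpinvmx D *m D) = P *m Q.
  have -> : P *m Q = mpinvmx C *m D by rewrite /D /P /Q !mulmxA.
  by rewrite -mulmxA (mulmxA D) mulmx_mpinvmxK.
have bridge : Z = mpinvmx B *m (P *m Q) *m mpinvmx D.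
  by rewrite mulmxA BP -mulmxA QD.
split.
- have -> : C *m R *m Z = C *m (B *m mpinvmx B *m (P *m Q)) *m mpinvmx D.
    by rewrite -CB bridge !mulmxA.
  by rewrite BB_PQ mulmxA CP /D /Q mulmxA.
- have -> : Z *m (C *m R)
      = mpinvmx B *m (P *m Q *m (mpinvmx D *m D)) *m R.
    by rewrite -DR bridge !mulmxA.
  by rewrite PQ_DD -(mulmxA _ (P *m Q)) -(mulmxA P) QR.
Qed.

Lemma mpinvmx_mul (F : realFieldType) (m k n : nat)
    (C : 'M[F]_(m, k)) (R : 'M[F]_(k, n)) :
  mpinvmx (C *m R) =
    mpinvmx (mpinvmx C *m C *m R) *m mpinvmx (C *m R *m mpinvmx R).
Proof.
apply: mpinvmx_eq.
have [AZ ZA] := mpinvmx_mul_projections C R.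
apply/and4P; split; rewrite ?AZ ?ZA; apply/eqP.
- have DR : C *m R = C *m R *m mpinvmx R *m R.
    by rewrite -!mulmxA (mulmxA R) mulmx_mpinvmxK.
  by rewrite [in X in _ *m X]DR mulmxA mulmx_mpinvmxK -DR.
- by rewrite mulmxA mpinvmx_mulmxK.
- exact: trmx_mpinvmx_mul.
- exact: trmx_mul_mpinvmx.
Qed.

Theorem theorem2 (K : realType) (m k n : nat)
    (C : 'M[K]_(m, k)) (R : 'M[K]_(k, n)) (A : 'M[K]_(m, n))
    (hA : A = C *m R) :
  mpinvmx A = mpinvmx (C *m R) /\
  mpinvmx (C *m R) =
    mpinvmx (mpinvmx C *m C *m R) *m mpinvmx (C *m R *m mpinvmx R).
Proof. by split; [rewrite hA | exact: mpinvmx_mul]. Qed.
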